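(* Let $K\subseteq L$ be a finite separable field extension of degree $n>1$, and assume that $K$ is infinite. Then $$\mathcal{C}(L/K)=n-d_{\max}(L/K).$$
   Context: Let $K\subseteq L$ be a finite field extension with $[L:K]>1$. A nonzero $K$-subspace $A\subseteq L$ is called a Chowla subspace if $[K(a):K]>\dim_K A$ for every $0\ne a\in A$. Define $\mathcal{C}(L/K)=\max\{\dim_K A:A\subseteq L\text{ is a Chowla }K\text{-subspace}\}$ and $d_{\max}(L/K)=\max\{[E:K]:K\subseteq E\subsetneq L\}$, the maximum over proper intermediate fields $E$ (with $E=K$ allowed). *)

(* Defs.v *)
From HB Require Import structures.
From mathcomp Require Import all_boot all_order all_algebra all_field.
From mathcomp Require Import boolp classical_sets cardinality.

Set Implicit Arguments.
Unset Strict Implicit.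
Unset Printing Implicit Defensive.

Import GRing.Theory.
Local Open Scope ring_scope.

(* For L : fieldExtType K the base field K is the subspace 1 of L, all        *)
(* dimensions are over K, and the terms of {subfield L} are exactly the       *)
(* intermediate fields of L / K.                                              *)

Definition chowla_subspace (K : fieldType) (L : fieldExtType K)
    (A : {vspace L}) : Prop :=
  A <> 0%VS /\
  forall a : L, a \in A -> a <> 0 -> (\dim A < \dim <<1; a>>%VS)%N.

(* All the dimensions involved are at most \dim {:L}, so the bounded maxima   *)
(* below are the maxima over all Chowla subspaces and over all proper         *)
(* intermediate fields: see chowla_dim_max and d_max_max.                     *)
Definition chowla_dim (K : fieldType) (L : fieldExtType K) : nat :=
  (\max_(m < (\dim {:L}).+1 |
         `[< exists A : {vspace L}, chowla_subspace A /\ \dim A = m >]) m)%N.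

Definition d_max (K : fieldType) (L : fieldExtType K) : nat :=
  (\max_(m < (\dim {:L}).+1 |
         `[< exists E : {subfield L}, E <> {:L}%VS :> {vspace L} /\
                                      \dim E = m >]) m)%N.

Lemma bounded_max (P : nat -> Prop) (N : nat) :
    (exists m, P m) -> (forall m, P m -> (m <= N)%N) ->
  P (\max_(m < N.+1 | `[< P m >]) m)%N /\
  forall m, P m -> (m <= \max_(m < N.+1 | `[< P m >]) m)%N.
Proof.
move=> [m0 Pm0] leN; have Plt m : P m -> (m < N.+1)%N by move/leN.
split=> [|m Pm]; last first.
  exact: (@leq_bigmax_cond _ (fun i : 'I_N.+1 => `[< P i >])
            (fun i => nat_of_ord i) (Ordinal (Plt m Pm)) (asboolT Pm)).
have PO : `[< P (Ordinal (Plt _ Pm0)) >] by exact/asboolP.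
by rewrite (bigmax_eq_arg _ PO); case: arg_maxnP => // i /asboolP.
Qed.

Lemma chowla_dim_max (K : fieldType) (L : fieldExtType K) :
    (1 < \dim {:L})%N ->
  (exists A : {vspace L}, chowla_subspace A /\ \dim A = chowla_dim L) /\
  forall A : {vspace L}, chowla_subspace A -> (\dim A <= chowla_dim L)%N.
Proof.
move=> n_gt1; pose P m := exists A : {vspace L}, chowla_subspace A /\ \dim A = m.
have [||PM leM] := @bounded_max P (\dim {:L}); last first.
- by split=> // A chA; apply: leM; exists A.
- by move=> _ [A [_ <-]]; rewrite dimvS ?subvf.
have /subvPn[x _ x1] : ~~ ({:L} <= 1)%VS.
  by apply: contraL n_gt1 => /dimvS; rewrite dimv1 -leqNgt.
exists 1%N, <[x]>%VS.
have x0 : x != 0 by apply: contraNneq x1 => ->; rewrite mem0v.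
have dx : \dim <[x]> = 1%N by rewrite dim_vline x0.
split=> //; split=> [x_0|_ /vlineP[k ->] /eqP]; first by rewrite x_0 dimv0 in dx.
rewrite scaler_eq0 negb_or dx => /andP[k0 _].
rewrite ltn_neqAle adim_gt0 andbT eq_sym; apply: contraNneq x1 => d1.
have -> : 1%VS = <<1; k *: x>>%VS.
  by apply/eqP; rewrite eqEdim subv_adjoin dimv1 d1.
by rewrite -[X in X \in _](scalerK k0) memvZ // memv_adjoin.
Qed.

Lemma d_max_max (K : fieldType) (L : fieldExtType K) :
    (1 < \dim {:L})%N ->
  (exists E : {subfield L}, E <> {:L}%VS :> {vspace L} /\ \dim E = d_max L) /\
  forall E : {subfield L}, E <> {:L}%VS :> {vspace L} ->
    (\dim E <= d_max L)%N.
Proof.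
move=> n_gt1.
pose P m := exists E : {subfield L}, E <> {:L}%VS :> {vspace L} /\ \dim E = m.
have [||PM leM] := @bounded_max P (\dim {:L}); last first.
- by split=> // E ltE; apply: leM; exists E.
- by move=> _ [E [_ <-]]; rewrite dimvS ?subvf.
exists 1%N, 1%AS; split; last by rewrite dimv1.
by move=> E1; rewrite -E1 dimv1 in n_gt1.
Qed.

(* Main.v *)
Require Import Defs.
From HB Require Import structures.
From mathcomp Require Import all_boot all_order all_algebra all_field.
From mathcomp Require Import boolp classical_sets cardinality.

Set Implicit Arguments.
Unset Strict Implicit.
Unset Printing Implicit Defensive.

Import GRing.Theory.
Local Open Scope ring_scope.

(** Let d be the largest degree over K of a proper intermediate field, and E a
    field attaining it.  Since d divides n and d < n, one has d <= n - d.

    Upper bound.  A Chowla subspace A either meets E trivially, so that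
    dim A <= n - d by counting dimensions, or contains some nonzero a in E, in
    which case dim A < [K(a) : K] <= d <= n - d ([chowla_dim_le]).

    Lower bound.  If A meets every proper intermediate field trivially, then
    each nonzero a in A generates L, so A is Chowla as soon as
    0 < dim A < n ([chowla_of_disjoint_subfields]).  Such an A of dimension
    n - d exists for two reasons.  First, there are only finitely many
    intermediate fields ([finitely_many_subfields]): if x is a primitive
    element, each field E is determined by the minimal polynomial of x over E
    ([minPolyOver_sub]), which is one of the finitely many monic divisors in
    L[X] of the minimal polynomial of x over K ([finitely_many_divisors]).
    Second, over an infinite field a vector space is not a finite union of
    proper subspaces ([subspaces_not_cover]); hence finitely many subspaces of
    dimension at most d have a common subspace of dimension n - d disjoint from
    all of them, built one vector at a time ([disjoint_from_all]). *)

(** If p = t * r is a proper factorization, q divides p and g = gcd(q, r), then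
    q = (q / g) * g where g divides r and, by Gauss's lemma, q / g divides t; so
    the products of representatives for t and for r suffice.  If p has no proper
    factorization, its divisors are associate to 1 or to p. *)
Lemma finitely_many_divisors (F : fieldType) (p : {poly F}) : p != 0 ->
  exists s : seq {poly F}, forall q, q %| p -> exists2 r, r \in s & q %= r.
Proof.
have [N] := ubnP (size p); elim: N p => // N IHN p /ltnSE-sizep p0.
have [[r [rp r_gt1 ltrp]]|irrp] :=
  pselect (exists r, [/\ r %| p, (1 < size r)%N & (size r < size p)%N]).
  have r0 : r != 0 by apply: dvdpN0 rp p0.
  have Dp := divpK rp; set t := p %/ r in Dp.
  have t0 : t != 0 by apply: contraNneq p0 => t0; rewrite -Dp t0 mul0r.
  have lttp : (size t < size p)%N.
    by move: r_gt1; rewrite -Dp size_mul //; case: (size r) => [|[|k]] // _;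
       rewrite !addnS /= ltnS leq_addr.
  have [sr srP] := IHN r (leq_trans ltrp sizep) r0.
  have [st stP] := IHN t (leq_trans lttp sizep) t0.
  exists [seq a * b | a <- st, b <- sr] => q qp.
  have Dq := divpK (dvdp_gcdl q r); set g := gcdp q r in Dq.
  have q't : q %/ g %| t.
    have g0 : g != 0 by rewrite gcdp_eq0 negb_and r0 orbT.
    have co : coprimep (q %/ g) (r %/ g).
      by apply: coprimep_div_gcd; rewrite r0 orbT.
    rewrite -(Gauss_dvdpl _ co) -(dvdp_mul2r _ _ g0) Dq -mulrA.
    by rewrite divpK ?dvdp_gcdr // Dp.
  have [a sta qa] := stP _ q't; have [b srb gb] := srP _ (dvdp_gcdr q r).
  exists (a * b); first exact: allpairs_f.
  by rewrite -Dq (eqp_trans (eqp_mulr _ qa)) ?eqp_mull.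
exists [:: 1; p] => q qp.
have [q_le1|q_gt1] := leqP (size q) 1.
  exists 1; rewrite ?inE ?eqxx // -size_poly_eq1.
  by rewrite eqn_leq q_le1 size_poly_gt0 (dvdpN0 qp).
exists p; first by rewrite !inE eqxx orbT.
rewrite -(dvdp_size_eqp qp) eqn_leq dvdp_leq //= leqNgt.
by apply/negP => ltqp; apply: irrp; exists q.
Qed.

(** The minimal polynomial m of x over E has its coefficients in G = E :&: F, so
    x has degree at most deg m over G: thus [L : G] <= [L : E], which forces
    G = E.  Applied both ways, this shows that the minimal polynomial of a
    primitive element determines the intermediate field. *)
Lemma minPolyOver_sub (K : fieldType) (L : fieldExtType K) (x : L)
    (E F : {subfield L}) :
    <<1; x>>%VS = {:L}%VS -> minPoly E x \is a polyOver F -> (E <= F)%VS.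
Proof.
move=> genx mF; pose G := (E :&: F)%AS.
have full (H : {subfield L}) : <<H; x>>%VS = {:L}%VS.
  by apply/eqP; rewrite eqEsubv subvf -genx adjoinSl ?sub1v.
have mG : minPoly E x \is a polyOver G.
  apply/polyOverP => i; rewrite memv_cap.
  by rewrite (polyOverP (minPolyOver E x)) (polyOverP mF).
have le_deg : (adjoin_degree G x <= adjoin_degree E x)%N.
  rewrite -ltnS -!size_minPoly dvdp_leq ?minPoly_dvdp ?root_minPoly //.
  by rewrite monic_neq0 ?monic_minPoly.
have /eqP eqGE : G == E :> {vspace L}.
  rewrite eqEdim capvSl /=.
  have degE_gt0 : (0 < adjoin_degree E x)%N.
    by have := adim_gt0 <<E; x>>%AS; rewrite dim_Fadjoin muln_gt0 => /andP[].
  have dimE := dim_Fadjoin E x; have := dim_Fadjoin G x.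
  rewrite !full in dimE * => dimG.
  by rewrite -(leq_pmul2l degE_gt0) -dimE dimG leq_mul2r le_deg orbT.
by rewrite -eqGE capvSr.
Qed.

Lemma finitely_many_subfields (K : fieldType) (L : fieldExtType K) :
  separable 1 {:L} ->
  exists s : seq {vspace L}, forall E : {subfield L}, (E : {vspace L}) \in s.
Proof.
move=> sepL; set x := separable_generator 1 {:L}.
have genx : <<1; x>>%VS = {:L}%VS.
  by rewrite -(eq_adjoin_separable_generator sepL) ?sub1v.
have [t tP] := finitely_many_divisors (monic_neq0 (monic_minPoly 1 x)).
(* [field_of r] picks an intermediate field whose minimal polynomial of x is *)
(* associate to r; when there is none, the value 0 is only a default.        *)
pose field_of (r : {poly L}) : {vspace L} :=
  if pselect (exists E : {subfield L}, minPoly E x %= r) is left exE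
  then projT1 (cid exE) else 0%VS.
exists (map field_of t) => E.
have [r tr Er] := tP _ (minPolyS x (sub1v E)).
apply/mapP; exists r => //; rewrite /field_of.
case: pselect => [exF|[]]; last by exists E.
case: (cid exF) => F /= Fr.
have eqEF : minPoly E x = minPoly F x.
  apply/eqP; rewrite -eqp_monic ?monic_minPoly //.
  by rewrite (eqp_trans Er) 1?eqp_sym.
apply/eqP; rewrite eqEsubv !(minPolyOver_sub genx) //.
  by rewrite -eqEF minPolyOver.
by rewrite eqEF minPolyOver.
Qed.

(** A subspace U not containing v meets the line w + K v in at most one point,
    so only finitely many parameters k are bad. *)
Lemma line_avoids (K : fieldType) (V : vectType K) (s : seq {vspace V})
    (v w : V) : infinite_set (setT : set K) ->
    (forall U, U \in s -> v \notin U) ->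
  exists k : K, forall U, U \in s -> w + k *: v \notin U.
Proof.
move=> infK vs.
have [bad badP] : exists bad : seq K,
    forall k U, U \in s -> w + k *: v \in U -> k \in bad.
  elim: s vs => [|U s IHs] vs; first by exists [::].
  have [|bad badP] := IHs; first by move=> W sW; rewrite vs // inE sW orbT.
  have [[k0 k0U]|noU] := pselect (exists k, w + k *: v \in U); last first.
    exists bad => k W; rewrite inE => /predU1P[->|/badP] kW; last exact: kW.
    by case: noU; exists k.
  exists (k0 :: bad) => k W; rewrite !inE.
  case/predU1P=> [-> kU|/badP h /h->]; last by rewrite orbT.
  apply/orP; left; apply: contraR (vs U (mem_head _ _)) => nek.
  (* Two distinct points of the line lying in U would put v in U. *)
  have -> : v = (k - k0)^-1 *: ((w + k *: v) - (w + k0 *: v)).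
    by rewrite opprD addrACA subrr add0r -scalerBl scalerK ?subr_eq0.
  by rewrite rpredZ // rpredB.
have [k /negP kbad] : exists k, ~ k \in bad.
  apply: contrapT => allbad; apply: infK; apply/finite_seqP; exists bad.
  apply/seteqP; split=> // k _ /=; apply: contrapT => kbad.
  by apply: allbad; exists k.
by exists k => U sU; apply: contra kbad; apply: badP sU.
Qed.

Lemma subspaces_not_cover (K : fieldType) (V : vectType K)
    (s : seq {vspace V}) : infinite_set (setT : set K) ->
    (forall U, U \in s -> U != fullv) ->
  exists v : V, forall U, U \in s -> v \notin U.
Proof.
move=> infK; elim: s => [|U s IHs] sP; first by exists 0.
have [|v vP] := IHs; first by move=> W sW; rewrite sP // inE sW orbT.
have [vU|vU] := boolP (v \in U); last first.
  by exists v => W; rewrite inE => /predU1P[->|/vP].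
have /subvPn[w _ wU] : ~~ ({:V} <= U)%VS.
  by apply: contra (sP U (mem_head _ _)) => sVU; rewrite eqEsubv subvf.
(* As v lies in U and w does not, the whole line w + K v avoids U; one of its *)
(* points also avoids the other subspaces, since v does.                      *)
have [k kP] := line_avoids w infK vP.
exists (w + k *: v) => W; rewrite inE => /predU1P[->|/kP//].
by rewrite rpredDr ?rpredZ.
Qed.

(** If A is disjoint from every U and dim A < k <= dim V - d, each A + U is a
    proper subspace; a vector v outside all of them can be added to A, because
    a relation u = a + c v with u in U and c nonzero would put v in A + U. *)
Lemma disjoint_from_all (K : fieldType) (V : vectType K)
    (s : seq {vspace V}) (d k : nat) : infinite_set (setT : set K) ->
    (forall U, U \in s -> (\dim U <= d)%N) -> (k + d <= \dim {:V})%N ->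
  exists2 A : {vspace V}, \dim A = k & forall U, U \in s -> (A :&: U = 0)%VS.
Proof.
move=> infK sP; elim: k => [|k IHk] le_kd.
  by exists 0%VS => [|U _]; rewrite ?dimv0 ?cap0v.
have [A dimA AP] := IHk (ltnW le_kd).
(* Adding the zero subspace to the family makes the new vector v lie outside *)
(* A itself, even when s is empty, so that the dimension does grow.          *)
have {}AP U : U \in 0%VS :: s -> (A :&: U = 0)%VS.
  by rewrite inE => /predU1P[->|/AP//]; rewrite capv0.
have {}sP U : U \in 0%VS :: s -> (\dim U <= d)%N.
  by rewrite inE => /predU1P[->|/sP//]; rewrite dimv0.
have [_ /mapP[U sU ->]|v vP] :=
    subspaces_not_cover (s := map (addv A) (0%VS :: s)) infK.
  apply: contraTneq le_kd => fullU; rewrite -ltnNge ltnS -fullU.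
  by rewrite dimv_disjoint_sum ?AP // dimA leq_add2l sP.
have {}vP U : U \in 0%VS :: s -> v \notin (A + U)%VS.
  by move=> sU; apply: vP; apply: map_f.
exists (A + <[v]>)%VS => [|U sU].
  have vA : v \notin A by have := vP _ (mem_head _ _); rewrite addv0.
  have v0 : v != 0 by apply: contraNneq vA => ->; rewrite mem0v.
  rewrite dimv_disjoint_sum ?dimA ?dim_vline ?v0 ?addn1 //.
  apply/eqP; rewrite -subv0; apply/subvP => u; rewrite memv_cap memv0.
  case/andP=> uA /vlineP[c Du]; move: uA; rewrite Du scaler_eq0.
  apply: contraLR; rewrite negb_or => /andP[c0 _].
  by apply: contra vA => cvA; rewrite -(scalerK c0 v) rpredZ.
have {}sU : U \in 0%VS :: s by rewrite inE sU orbT.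
apply/eqP; rewrite -subv0; apply/subvP => u; rewrite memv_cap memv0.
case/andP=> /memv_addP[a aA [_ /vlineP[c ->] Du]] uU.
have [c0|c0] := eqVneq c 0.
  rewrite Du c0 scale0r addr0 in uU *.
  by rewrite -memv0 -(AP _ sU) memv_cap aA.
case/negP: (vP _ sU).
have -> : v = c^-1 *: (u - a) by rewrite Du addrC addKr scalerK.
by rewrite rpredZ // addrC memv_add // rpredN.
Qed.

(** By the tower law [E : K] is a proper divisor of [L : K], hence at most half
    of it. *)
Lemma dim_proper_subfield_le_codim (K : fieldType) (L : fieldExtType K)
    (E : {subfield L}) :
  E <> {:L}%VS :> {vspace L} -> (\dim E <= \dim {:L} - \dim E)%N.
Proof.
move=> ltE; have /dvdnP[q Dq] : (\dim E %| \dim {:L})%N.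
  exact: (@field_dimS _ _ E {:L}%AS (subvf _)).
case: q Dq => [|[|q]] Dq; first by have := adim_gt0 {:L}; rewrite Dq.
  by case: ltE; apply/eqP; rewrite eqEdim subvf Dq mul1n /=.
by rewrite Dq !mulSn addKn leq_addr.
Qed.

Lemma chowla_dim_le (K : fieldType) (L : fieldExtType K)
    (A : {vspace L}) (E : {subfield L}) :
    chowla_subspace A -> E <> {:L}%VS :> {vspace L} ->
  (\dim A <= \dim {:L} - \dim E)%N.
Proof.
move=> [_ chA] ltE.
have [AE0|] := eqVneq (A :&: E)%VS 0%VS.
  by rewrite leq_subRL ?dimvS ?subvf // addnC -dimv_disjoint_sum ?dimvS ?subvf.
rewrite -vpick0; set a := vpick _ => a0.
have := memv_pick (A :&: E)%VS; rewrite -/a memv_cap => /andP[aA aE].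
apply: leq_trans (dim_proper_subfield_le_codim ltE).
apply: leq_trans (ltnW (chA a aA (elimN eqP a0))) (dimvS _).
by rewrite sub_adjoin1v.
Qed.

Lemma chowla_of_disjoint_subfields (K : fieldType) (L : fieldExtType K)
    (A : {vspace L}) : A != 0%VS -> (\dim A < \dim {:L})%N ->
    (forall E : {subfield L}, E <> {:L}%VS :> {vspace L} ->
      (A :&: E = 0)%VS) ->
  chowla_subspace A.
Proof.
move=> /eqP A0 ltA AE; split=> // a aA a0.
have [->//|/eqP/(AE <<1; a>>%AS) Aa0] := eqVneq <<1; a>>%VS {:L}%VS.
by case: a0; apply/eqP; rewrite -memv0 -Aa0 memv_cap aA memv_adjoin.
Qed.

Theorem theorem4p7 (K : fieldType) (L : fieldExtType K) (n : nat)
  (dimL : \dim {:L} = n) (n_gt1 : (1 < n)%N)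
  (sepL : separable 1 {:L}) (infK : infinite_set (setT : set K)) :
  chowla_dim L = (n - d_max L)%N.
Proof.
rewrite -dimL in n_gt1 *.
have [[A [chA dimA]] chowla_max] := chowla_dim_max n_gt1.
have [[E [ltE dimE]] field_max] := d_max_max n_gt1.
apply/eqP; rewrite eqn_leq; apply/andP; split.
  by rewrite -dimA -dimE chowla_dim_le.
have [s sP] := finitely_many_subfields sepL.
have d_le : (d_max L <= \dim {:L})%N by rewrite -dimE dimvS ?subvf.
have [||B dimB BP] := @disjoint_from_all _ _
    [seq U <- s | (\dim U <= d_max L)%N] (d_max L) (\dim {:L} - d_max L) infK.
- by move=> U; rewrite mem_filter => /andP[].
- by rewrite subnK.
(* It remains to see 0 < n - d < n; the first holds because 0 < d <= n - d. *)
rewrite -dimB; apply: chowla_max; apply: chowla_of_disjoint_subfields.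
- rewrite -dimv_eq0 dimB -lt0n (leq_trans (adim_gt0 E)) //.
  by rewrite -dimE dim_proper_subfield_le_codim.
- rewrite dimB ltn_subrL -dimE adim_gt0 /=; exact: ltnW.
by move=> F ltF; apply: BP; rewrite mem_filter sP field_max.
Qed.
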